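(* Let $H$ be a graph with $\chi(H)=r\ge 3$. Then $$\delta_{\chi}^{\mathrm{VC}}(H)\in\left\{\frac{r-3}{r-2},\ \frac{r-2}{r-1}\right\},$$ and the larger value $\frac{r-2}{r-1}$ occurs if and only if the decomposition family $\mathcal M(H)$ contains no forest.
   Context: All graphs are finite and simple. A graph is $H$-free if it contains no (not necessarily induced) subgraph isomorphic to $H$. $\delta(G)$ denotes minimum degree and $\chi$ the chromatic number. The VC-dimension $\mathrm{VC}(G)$ of a graph $G$ is the maximum size of a set $S\subseteq V(G)$ such that $\{N_G(v)\cap S: v\in V(G)\}=2^S$. The bounded-VC chromatic threshold $\delta_\chi^{\mathrm{VC}}(H)$ is the infimum of all $\gamma>0$ such that, for every integer $d\ge 1$, there is a constant $C=C(\gamma,d,H)$ such that every $H$-free graph $G$ with $\delta(G)\ge\gamma|V(G)|$ and $\mathrm{VC}(G)\le d$ has $\chi(G)\le C$. For a graph $H$ with $\chi(H)=r$, the decomposition family $\mathcal M(H)$ consists of all graphs $H[B]$ arising from a partition $V(H)=A_1\cup\cdots\cup A_{r-2}\cup B$ in which $A_1,\dots,A_{r-2}$ are independent sets of $H$. *)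

(* Defs.v *)
From mathcomp Require Import all_boot all_order all_algebra.
From mathcomp Require Import boolp classical_sets reals.

Set Implicit Arguments.
Unset Strict Implicit.
Unset Printing Implicit Defensive.

Import Order.TTheory GRing.Theory Num.Theory.

Local Open Scope ring_scope.

Record sgraph := SGraph {
  vertex :> finType;
  adj : rel vertex;
  adj_sym : symmetric adj;
  adj_irrefl : irreflexive adj
}.

Section Graph.
Variable G : sgraph.
Implicit Types (x y : G) (S : {set G}).

Definition neighbours x : {set G} := [set y | adj x y].

(* The neutral element #|G| exceeds every degree, so this is the true minimum
   when G has a vertex; for the empty graph it is 0. *)
Definition min_degree : nat := \big[minn/#|G|]_(x : G) #|neighbours x|.

Definition colorable (k : nat) : bool :=
  [exists f : {ffun G -> 'I_k}, [forall x, forall y, adj x y ==> (f x != f y)]].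

Lemma colorable_card : colorable #|G|.
Proof.
apply/existsP; exists [ffun x => enum_rank x].
apply/forallP => x; apply/forallP => y; apply/implyP => xy.
rewrite !ffunE (inj_eq enum_rank_inj); apply: contraTneq xy => ->.
by rewrite adj_irrefl.
Qed.

Definition chromatic_number : nat := ex_minn (ex_intro colorable #|G| colorable_card).

Definition shattered S : bool :=
  [set neighbours v :&: S | v : G] == powerset S.

Definition vc_dim : nat := \max_(S : {set G} | shattered S) #|S|.

Definition independent S : bool :=
  [forall x in S, forall y in S, ~~ adj x y].

(* ucycle alone also accepts sequences of length at most 2, e.g. the two ends
   of an edge. *)
Definition forest : Prop := forall c : seq G, ucycle (@adj G) c -> (size c <= 2)%N.

Section Induced.
Variable B : {set G}.

Definition induced_adj : rel {x : G | x \in B} := fun u v => adj (val u) (val v).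

Lemma induced_adj_sym : symmetric induced_adj.
Proof. by move=> u v; apply: adj_sym. Qed.

Lemma induced_adj_irrefl : irreflexive induced_adj.
Proof. by move=> u; apply: adj_irrefl. Qed.

Definition induced : sgraph := SGraph induced_adj_sym induced_adj_irrefl.

End Induced.
End Graph.

Definition isomorphic (F G : sgraph) : Prop :=
  exists2 f : F -> G, bijective f & forall x y, adj (f x) (f y) = adj x y.

Definition contains_copy (H G : sgraph) : Prop :=
  exists2 f : H -> G, injective f & forall x y, adj x y -> adj (f x) (f y).

Definition H_free (H G : sgraph) : Prop := ~ contains_copy H G.

(* Parts of the partition may be empty. *)
Definition decomposition_family (H F : sgraph) : Prop :=
  exists (A : 'I_(chromatic_number H - 2) -> {set H}) (B : {set H}),
    [/\ (\bigcup_i A i) :|: B = [set: H],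
        forall i j, i != j -> [disjoint A i & A j],
        forall i, [disjoint A i & B],
        forall i, independent (A i)
      & isomorphic F (induced B)].

Definition vc_admissible (R : realType) (H : sgraph) (gamma : R) : Prop :=
  0 < gamma /\
  forall d : nat, (1 <= d)%N ->
    exists C : nat, forall G : sgraph,
      H_free H G ->
      gamma * #|G|%:R <= (min_degree G)%:R ->
      (vc_dim G <= d)%N ->
      (chromatic_number G <= C)%N.

Definition vc_chromatic_threshold (R : realType) (H : sgraph) : R :=
  inf [set gamma : R | vc_admissible H gamma]%classic.

(* inf returns a default value on sets without an infimum; this shows that the
   default never arises in vc_chromatic_threshold. *)
Lemma has_inf_vc_admissible (R : realType) (H : sgraph) :
  has_inf [set gamma : R | vc_admissible H gamma]%classic.
Proof.
split; last by exists 0 => g [g0 _]; apply: ltW.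
exists 2; split => // d _; exists 0%N => G _ hdeg _.
have hmin : (min_degree G <= #|G|)%N.
  by rewrite /min_degree; elim/big_rec: _ => // x m _; apply/leq_trans/geq_minr.
have G0 : #|G| = 0%N.
  move: hdeg; rewrite -natrM ler_nat mul2n -addnn => /leq_trans/(_ hmin).
  by rewrite -{3}[#|G|]addn0 leq_add2l leqn0 => /eqP.
by rewrite /chromatic_number; case: ex_minnP => k _ /(_ _ (colorable_card G)); rewrite G0.
Qed.

(* Main.v *)
(** Lower bounds: take a graph [F] of girth larger than [#|H|] and large chromatic number
    (Erdős), and join it completely to [m] independent sets of size [#|F|]. The minimum
    degree is at least [m / (m + 1)] times the order, the VC dimension is at most [m + 3]
    because [F] has no 4-cycle, and a copy of [H] would split [H] into [m] independent sets
    and a forest. For [m = r - 3] this would give a colouring of [H] with [r - 1] colours,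
    and for [m = r - 2] a forest in the decomposition family.

    Upper bounds: above [(r - 2) / (r - 1)] the Erdős–Stone theorem bounds the order of [G].
    Suppose now that [H] splits into [r - 2] independent sets and a forest [B], and that the
    minimum degree exceeds [(r - 3) / (r - 2)] times the order. As the VC dimension is
    bounded, the vertices fall into boundedly many classes of vertices with nearly equal
    neighbourhoods. If the chromatic number is large, some class contains a copy of [B]; the
    common neighbourhood of this copy is nearly as large as the minimum degree, hence so
    dense that by Erdős–Stone it contains a complete [(r - 2)]-partite graph with large
    parts, and these together with [B] contain [H]. *)

Require Import Defs.
From mathcomp Require Import boolp reals.
From mathcomp Require Import all_boot all_order all_algebra zify ring.

Set Implicit Arguments.
Unset Strict Implicit.
Unset Printing Implicit Defensive.

(** * Colourings and forests *)

Lemma chromatic_number_le (G : sgraph) (T : finType) (f : G -> T) :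
  (forall x y, adj x y -> f x != f y) -> chromatic_number G <= #|T|.
Proof.
move=> fP; rewrite /chromatic_number; case: ex_minnP => k _; apply.
apply/existsP; exists [ffun x => enum_rank (f x)].
apply/forallP => x; apply/forallP => y; apply/implyP => /fP.
by rewrite !ffunE (inj_eq enum_rank_inj).
Qed.

Lemma chromatic_number_coloring (G : sgraph) (k : nat) :
  chromatic_number G <= k ->
  exists f : G -> 'I_k, forall x y, adj x y -> f x != f y.
Proof.
rewrite /chromatic_number; case: ex_minnP => m /existsP[f /forallP fP] _ mk.
exists (fun x => widen_ord mk (f x)) => x y xy.
by have /forallP/(_ y)/implyP/(_ xy) := fP x.
Qed.

Lemma chromatic_number_le_card (G : sgraph) : chromatic_number G <= #|G|.
Proof.
by apply: (@chromatic_number_le G G id) => x y; apply: contraTneq => ->; rewrite adj_irrefl.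
Qed.

Lemma min_degree_le (G : sgraph) (x : G) : min_degree G <= #|neighbours x|.
Proof.
rewrite /min_degree; have: x \in index_enum G by rewrite mem_index_enum.
elim: (index_enum G) => // y s IHs; rewrite inE big_cons.
by case/predU1P => [->|/IHs]; [apply: geq_minl|apply/leq_trans/geq_minr].
Qed.

(** Greedy colouring: a vertex of low degree is set aside, the rest is coloured, and a free colour
    remains for it. Contrapositively, a set without such a colouring has a nonempty subset in which
    all degrees exceed [t]. *)
Lemma degenerate_coloring (G : sgraph) (t : nat) (C : {set G}) :
  (forall U : {set G}, U \subset C -> U != set0 ->
     exists2 u, u \in U & #|neighbours u :&: U| <= t) ->
  exists f : G -> 'I_t.+1, {in C &, forall x y, adj x y -> f x != f y}.
Proof.
have [n] := ubnP #|C|; elim: n => // n IHn in C * => leCn degC.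
have [->|C0] := eqVneq C set0; first by exists (fun=> ord0) => x y; rewrite inE.
have [u uC degu] := degC C (subxx _) C0.
have [|U sU U0|f fP] := IHn (C :\ u).
- by rewrite (cardsD1 u) uC in leCn.
- by apply: degC => //; apply: subset_trans sU (subsetDl _ _).
have [c cP] : exists c, c \notin [set f y | y in neighbours u :&: C].
  apply/existsP; rewrite -negb_forall; apply/negP => /forallP all_c.
  have : #|'I_t.+1| <= #|[set f y | y in neighbours u :&: C]|.
    by apply: subset_leq_card; apply/subsetP => c _; apply: all_c.
  by rewrite card_ord => /leq_trans/(_ (leq_imset_card _ _)); lia.
have cP' y : y \in C -> adj u y -> c != f y.
  move=> yC uy; apply: contraNneq cP => ->.
  by apply: imset_f; rewrite !inE uy.
exists (fun x => if x == u then c else f x) => x y xC yC xy.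
have [xu|xu] := eqVneq x u; have [yu|yu] := eqVneq y u.
- by rewrite xu yu adj_irrefl in xy.
- by apply: cP' => //; rewrite -xu.
- by rewrite eq_sym; apply: cP' => //; rewrite -yu adj_sym.
- by apply: fP => //; rewrite !inE ?xu ?yu.
Qed.

(** Otherwise any path in [B] could be prolonged at its first vertex: a neighbour other than the
    second vertex is either new or closes a cycle. *)
Lemma forest_low_degree (F : sgraph) (B : {set F}) :
  forest F -> B != set0 -> exists2 b, b \in B & #|neighbours b :&: B| <= 1.
Proof.
move=> forF /set0Pn[b0 b0B]; apply/exists_inP; rewrite -[X in is_true X]negbK negb_exists_in.
apply/negP => /forall_inP degB.
have long_path n : exists x p, [/\ path (@adj F) x p, uniq (x :: p), size p = n
                                 & all [in B] (x :: p)].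
  elim: n => [|n [x [p [pth unq szp allB]]]]; first by exists b0, [::]; rewrite /= b0B.
  have xB : x \in B by case/andP: allB.
  have : 0 < #|(neighbours x :&: B) :\ head x p|.
    have := degB x xB; rewrite -ltnNge (cardsD1 (head x p)).
    by case: (_ \in _) => /=; lia.
  case/card_gt0P => y; rewrite !inE => /and3P[yh xy yB].
  have [yp|ynp] := boolP (y \in x :: p); last first.
    exists y, (x :: p); split=> //=; rewrite ?szp ?yB // -?(adj_sym y) ?pth ?ynp //.
      by rewrite adj_sym xy.
  move: yp; rewrite inE => /orP[/eqP yx|yp]; first by rewrite yx adj_irrefl in xy.
  case/splitPr: yp => p1 p2 in pth unq yh *.
  have : ucycle (@adj F) (x :: rcons p1 y).
    apply/andP; split.
      rewrite /= rcons_path last_rcons -adj_sym xy andbT.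
      by move: pth; rewrite cat_path rcons_path /= => /and3P[-> ->].
    by move: unq; rewrite -cat_rcons -cat_cons cat_uniq => /and3P[].
  move/forF; rewrite /= size_rcons.
  by case: p1 yh {pth unq} => //=; rewrite eqxx.
have [x [p [_ /card_uniqP unq szp _]]] := long_path #|F|.
by have := max_card [in x :: p]; rewrite unq /= szp ltnn.
Qed.

(** A vertex [b] with at most one neighbour is embedded last: the image of that neighbour has too
    many neighbours in [U] for the other vertices to use them all up. *)
Lemma forest_embedding (F G : sgraph) (U : {set G}) :
  forest F -> U != set0 ->
  (forall u, u \in U -> #|F| <= #|neighbours u :&: U|) ->
  exists g : F -> G, [/\ injective g, forall x, g x \in U
    & forall x y, adj x y -> adj (g x) (g y)].
Proof.
move=> forF /set0Pn[u0 u0U] degU.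
suff [g [gI gU gA]] : exists g : F -> G, [/\ {in [set: F] &, injective g},
    {in [set: F], forall x, g x \in U}
    & {in [set: F] &, forall x y, adj x y -> adj (g x) (g y)}].
  by exists g; split=> [x y|x|x y]; [apply: gI|apply: gU|apply: gA]; rewrite inE.
move: [set: F] => B.
have [n] := ubnP #|B|; elim: n => // n IHn in B * => leBn.
have [->|B0] := eqVneq B set0; first by exists (fun=> u0); split=> x; rewrite inE.
have [b bB degb] := forest_low_degree forF B0.
have [|g [gI gU gA]] := IHn (B :\ b); first by rewrite (cardsD1 b) bB in leBn.
have [Z [ZU cZ adjZ]] : exists Z : {set G}, [/\ Z \subset U, #|F| <= #|Z| &
    forall y z, y \in B -> adj b y -> z \in Z -> adj (g y) z].
  have [N0|[c]] := set_0Vmem (neighbours b :&: B).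
    exists (neighbours u0 :&: U); split; [exact: subsetIr|exact: degU|].
    by move=> y z yB by_; have := in_set0 y; rewrite -N0 !inE by_ yB.
  move=> cN; have /andP[bc cB] : adj b c && (c \in B) by rewrite !inE in cN.
  have cb : c != b by apply: contraTneq bc => ->; rewrite adj_irrefl.
  exists (neighbours (g c) :&: U); split; first exact: subsetIr.
    by apply: degU; apply: gU; rewrite !inE cb.
  move=> y z yB by_; rewrite !inE => /andP[+ _].
  suff -> : y = c by [].
  by apply: (card_le1_eqP degb); rewrite !inE ?by_ ?bc ?yB ?cB.
have [z zZ zg] : exists2 z, z \in Z & z \notin g @: (B :\ b).
  apply/exists_inP; rewrite -[X in is_true X]negbK negb_exists_in.
  apply/negP => /forall_inP sub.
  have : #|Z| <= #|g @: (B :\ b)|.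
    by apply: subset_leq_card; apply/subsetP => z /sub; rewrite negbK.
  have : #|g @: (B :\ b)| <= #|B :\ b| := leq_imset_card _ _.
  have : #|B| <= #|F| := max_card _.
  by rewrite (cardsD1 b B) bB; lia.
have zg' y : y \in B -> y != b -> z != g y.
  by move=> yB yb; apply: contraNneq zg => ->; apply: imset_f; rewrite !inE yb.
exists (fun x => if x == b then z else g x); split.
- move=> x y xB yB; have [->|xb] := eqVneq x b; have [->//|yb] := eqVneq y b.
  + by move/eqP; rewrite (negPf (zg' y yB yb)).
  + by move/esym/eqP; rewrite (negPf (zg' x xB xb)).
  + by apply: gI; rewrite !inE ?xb ?yb.
- move=> x xB; have [_|xb] := eqVneq x b; first exact: (subsetP ZU).
  by apply: gU; rewrite !inE xb.
- move=> x y xB yB xy; have [xb|xb] := eqVneq x b; have [yb|yb] := eqVneq y b.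
  + by rewrite xb yb adj_irrefl in xy.
  + by rewrite adj_sym; apply: adjZ => //; rewrite -xb.
  + by apply: adjZ => //; rewrite -yb adj_sym.
  + by apply: gA; rewrite // !inE ?xb ?yb.
Qed.

(** * The Erdős–Stone theorem *)

Lemma pigeonhole (S T : finType) (A : {set S}) (B : {set T}) (f : S -> T) (a : nat) :
  {in A, forall x, f x \in B} -> a * #|B| < #|A| ->
  exists2 y, y \in B & a < #|[set x in A | f x == y]|.
Proof.
move=> fB; apply: contraPP => noy.
apply/negP; rewrite -leqNgt -sum1_card (partition_big f [in B]) //= mulnC -sum_nat_const.
apply: leq_sum => y yB; rewrite sum1dep_card leqNgt; apply/negP => ay.
by apply: noy; exists y.
Qed.

Definition initial_subset (T : finType) (a : nat) (X : {set T}) : {set T} :=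
  [set x in take a (enum X)].

Lemma initial_subset_sub (T : finType) (a : nat) (X : {set T}) : initial_subset a X \subset X.
Proof. by apply/subsetP => x; rewrite inE => /mem_take; rewrite mem_enum. Qed.

Lemma card_initial_subset (T : finType) (a : nat) (X : {set T}) :
  a <= #|X| -> #|initial_subset a X| = a.
Proof.
move=> aX; rewrite cardsE (card_uniqP _) ?take_uniq ?enum_uniq //.
by rewrite size_takel // -cardE.
Qed.

Section CompleteParts.
Variable G : sgraph.
Implicit Types (X Y W : {set G}) (s : seq {set G}).

Definition complete_pair X Y : bool := [forall x in X, forall y in Y, adj x y].

Lemma complete_pairP X Y :
  reflect {in X & Y, forall x y, adj x y} (complete_pair X Y).
Proof.
apply: (iffP forall_inP) => [h x y xX yY|h x xX]; last by apply/forall_inP => y; apply: h.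
by have /forall_inP := h x xX; apply.
Qed.

Definition complete_parts a W s : bool :=
  pairwise complete_pair s && all (fun X => (X \subset W) && (#|X| == a)) s.

End CompleteParts.

(** Both sides count the nonadjacent pairs of a vertex in [W] and a vertex in a part. *)
Lemma sum_parts_nonadjacent (G : sgraph) (W : {set G}) (s : seq {set G}) :
  \sum_(w in W) \sum_(X <- s) #|X :\: neighbours w| =
  \sum_(X <- s) \sum_(x in X) #|W :\: neighbours x|.
Proof.
have cD (Y : {set G}) v : #|Y :\: neighbours v| = \sum_(y in Y) ~~ adj v y.
  rewrite -sum1_card big_mkcond [RHS]big_mkcond; apply: eq_bigr => y _.
  by rewrite !inE; case: (y \in Y); case: (adj v y).
rewrite exchange_big; apply: eq_bigr => X _ /=.
under eq_bigr do rewrite cD; rewrite exchange_big; apply: eq_bigr => x _ /=.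
by rewrite cD; apply: eq_bigr => w _; rewrite adj_sym.
Qed.

(* The minimum degree form, with epsilon = 1/q. In the induction step, a positive proportion
   of the vertices of [W] have at least [a] neighbours in each part of a complete partite
   graph with much larger parts, and [a] of them have the same neighbours in it. *)
Lemma erdos_stone (k a q : nat) : 0 < q ->
  exists N, forall (G : sgraph) (W : {set G}), N <= #|W| ->
    {in W, forall w, q * k * #|W :\: neighbours w| <= q.-1 * #|W|} ->
    exists2 s, size s = k.+1 & complete_parts a W s.
Proof.
move=> q0; elim: k a => [|k IHk] a.
  exists a => G W aW _; exists [:: initial_subset a W] => //.
  by rewrite /complete_parts /= initial_subset_sub card_initial_subset ?eqxx.
(* This [t] leaves at least [#|W| / (2 * q)] good vertices; the bound on [#|W|] then makes them more
   than [a] times the number of possible traces on the [k.+1 * t] vertices of the parts. *)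
pose t := 2 * a.+1 * q; have [N0 IH] := IHk t.
exists (maxn N0 (2 * q * (a * 2 ^ (k.+1 * t)).+1)) => G W.
rewrite geq_max => /andP[N0W NW] degW.
have [||s szs /andP[pws allsW]] := IH G W => //.
  by move=> w wW; apply: leq_trans (degW w wW); rewrite leq_mul2r leq_mul2l leqnSn !orbT.
have sP X : X \in s -> X \subset W /\ #|X| = t.
  by move/(allP allsW)/andP=> [? /eqP].
pose Good := [set w in W | all (fun X => a <= #|X :&: neighbours w|) s].
(* Counted from the parts: each of their vertices has at most [#|W| * q.-1 / (q * k.+1)]
   nonneighbours in [W]. *)
have sum_bad : q * \sum_(w in W) \sum_(X <- s) #|X :\: neighbours w| <= t * (q.-1 * #|W|).
  rewrite -(leq_pmul2l (ltn0Sn k)) sum_parts_nonadjacent mulnA (mulnC k.+1 q) big_distrr /=.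
  apply: (@leq_trans (\sum_(X <- s) t * (q.-1 * #|W|))); last first.
    by rewrite big_const_seq count_predT szs iter_addn_0 mulnC.
  rewrite big_seq [X in _ <= X]big_seq; apply: leq_sum => X /sP[XW cX].
  rewrite big_distrr /= -cX -sum_nat_const; apply: leq_sum => x xX.
  by apply: degW; apply: (subsetP XW).
have bad_le : (t - a) * #|W :\: Good| <= \sum_(w in W) \sum_(X <- s) #|X :\: neighbours w|.
  rewrite mulnC -sum_nat_const [X in _ <= X](big_setID (W :\: Good)) /=.
  apply: leq_trans (leq_addr _ _).
  rewrite (setIidPr (subsetDl _ _)); apply: leq_sum => w.
  rewrite !inE => /andP[+ wW]; rewrite wW /= => /allPn[X Xs].
  rewrite -ltnNge => wX; rewrite (big_rem X) //=; apply: leq_trans (leq_addr _ _).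
  by have := cardsID (neighbours w) X; have [_ ->] := sP X Xs; lia.
have cW : #|W| = #|Good| + #|W :\: Good|.
  by rewrite -(cardsID Good W) (setIidPr _) //; apply/subsetP => w; rewrite inE => /andP[].
have good_ge : #|W| <= 2 * q * #|Good|.
  have h : q * ((t - a) * #|W :\: Good|) <= t * (q.-1 * #|W|).
    by apply: leq_trans sum_bad; rewrite leq_mul2l bad_le orbT.
  move: q0 h cW; rewrite /t; move: #|W :\: Good| #|Good| #|W| => b g w.
  clear; case: q => // q _ h cW.
  (* Here [q] stands for the former [q.-1]. *)
  have {}h : (2 * q + 1) * b <= 2 * q * w.
    rewrite -(leq_pmul2l (ltn0Sn a)) -(leq_pmul2l (ltn0Sn q)).
    apply: leq_trans (leq_trans h _); last by rewrite /=; lia.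
    rewrite leq_mul2l /= mulnA leq_mul2r; apply/orP; right; lia.
  by nia.
pose K := \bigcup_(X <- s) X.
have cK : #|K| <= k.+1 * t.
  apply: (@leq_trans (\sum_(X <- s) #|X|)).
    rewrite /K; elim: (s) => [|X s' IHs]; first by rewrite !big_nil cards0.
    by rewrite !big_cons (leq_trans (leq_card_setU _ _)) // leq_add2l.
  rewrite (eq_big_seq (fun=> t)) => [|X /sP[]//].
  by rewrite big_const_seq count_predT szs iter_addn_0 mulnC.
have [||Z _ cZ] := @pigeonhole _ _ Good (powerset K) (fun w => K :&: neighbours w) a.
- by move=> w _; rewrite inE subsetIl.
- rewrite card_powerset -(ltn_pmul2l (_ : 0 < 2 * q)) ?muln_gt0 //.
  apply: leq_trans good_ge; apply: leq_trans NW; rewrite ltn_pmul2l ?muln_gt0 // ltnS.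
  by rewrite leq_mul2l leq_pexp2l ?orbT.
pose P := initial_subset a [set x in Good | K :&: neighbours x == Z].
have PZ w : w \in P -> w \in Good /\ K :&: neighbours w = Z.
  by move/(subsetP (initial_subset_sub _ _)); rewrite inE => /andP[? /eqP].
have KX X : X \in s -> X \subset K by move=> Xs; rewrite /K (big_rem X) //= subsetUl.
exists (P :: [seq initial_subset a (X :&: Z) | X <- s]); first by rewrite /= size_map szs.
(* A single good vertex with trace [Z] shows that [Z] meets every part in at least [a] vertices. *)
have Good0 : exists w, (w \in Good) && (K :&: neighbours w == Z).
  by case/card_gt0P: (leq_ltn_trans (leq0n a) cZ) => w; rewrite inE; exists w.
case: Good0 => w0 /andP[w0G /eqP w0Z].
rewrite /complete_parts /= pairwise_map; apply/and3P; split; [apply/andP; split| |].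
- apply/allP => _ /mapP[X Xs ->]; apply/complete_pairP => w x /PZ[_ wZ].
  move/(subsetP (initial_subset_sub _ _)); rewrite inE -wZ !inE => /and3P[_ _ //].
- apply: sub_pairwise pws => X Y /complete_pairP XY; apply/complete_pairP => x y.
  move=> /(subsetP (initial_subset_sub _ _)) /setIP[xX _].
  by move=> /(subsetP (initial_subset_sub _ _)) /setIP[yY _]; apply: XY.
- rewrite card_initial_subset ?(ltnW cZ) // eqxx andbT; apply/subsetP => w /PZ[].
  by rewrite inE => /andP[].
- apply/allP => _ /mapP[X Xs ->]; have [XW _] := sP X Xs.
  rewrite (subset_trans (initial_subset_sub _ _)) ?card_initial_subset //=.
    rewrite -w0Z setIA (setIidPl (KX X Xs)).
    by move: w0G; rewrite inE => /andP[_ /(allP)]; apply.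
  by apply: subset_trans XW; apply: subsetIl.
Qed.

(** * Bounded VC dimension *)

Lemma card_bigcup_le (I T : finType) (P : pred I) (E : I -> {set T}) :
  #|\bigcup_(i | P i) E i| <= \sum_(i | P i) #|E i|.
Proof.
elim/big_rec2: _ => [|i n A _ IH]; first by rewrite cards0.
by rewrite (leq_trans (leq_card_setU _ _)) // leq_add2l.
Qed.

Lemma leq_wexp2r (m n e : nat) : m <= n -> m ^ e <= n ^ e.
Proof. by case: e => // e mn; rewrite leq_exp2r. Qed.

(** Bernoulli's inequality makes [(1 + 1/(q-1))^q] at least 2 when [q > 1]; the statement avoids the
    division. *)
Lemma double_expn_pred (q : nat) : 0 < q -> 2 * q.-1 ^ q <= q ^ q.
Proof.
case: q => // q _ /=.
have bernoulli j : q ^ j * (q + j) <= q * q.+1 ^ j.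
  elim: j => [|j IHj]; first by rewrite addn0 mulnC.
  rewrite !expnSr mulnA; apply: leq_trans (leq_mul IHj (leqnn q.+1)).
  by rewrite -!mulnA leq_mul2l; apply/orP; right; nia.
case: q bernoulli => [|q] bernoulli; first by rewrite expn1.
rewrite -(leq_pmul2l (ltn0Sn q)); apply: leq_trans (bernoulli q.+2).
by rewrite mulnA mulnC leq_mul2l; apply/orP; right; lia.
Qed.

Lemma double_expn_pred_mul (q u : nat) : 0 < q -> 2 ^ u * q.-1 ^ (q * u) <= q ^ (q * u).
Proof. by move=> q0; rewrite !expnM -expnMn leq_wexp2r //; apply: double_expn_pred. Qed.

Lemma affine_lt_expn2 (a b : nat) : exists w, a + b * w < 2 ^ w.
Proof.
(* As [v < 2 ^ v], the right side is at least [(v + 1)^2], whereas [a + b * (2 * v) <= v + v^2]. *)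
exists (2 * (a + 2 * b)); set v := a + 2 * b.
rewrite mul2n -addnn expnD.
have : v < 2 ^ v by apply: ltn_expl.
by move: (2 ^ v) => y; rewrite /v; nia.
Qed.

(** For [s = e * 2 ^ w] and [e > 1] the ratio [(e / (e - 1))^s] is at least [2 ^ 2 ^ w], while the
    polynomial factor is at most 2 to a power linear in [w]. The square counts the pairs in the
    union bound of [separated_vertices_bounded]. *)
Lemma expn_dominates (d e : nat) : 0 < e ->
  exists s, (s.+1 ^ d).+1 ^ 2 * e.-1 ^ s < e ^ s.
Proof.
move=> e0; have [w hw] := affine_lt_expn2 (2 + 2 * d * e.+1) (2 * d).
exists (e * 2 ^ w).
have [->|pos] := eqVneq (e.-1 ^ (e * 2 ^ w)) 0; first by rewrite muln0 expn_gt0 e0.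
apply: leq_trans (double_expn_pred_mul (2 ^ w) e0); rewrite ltn_pmul2r ?lt0n //.
apply: leq_ltn_trans (_ : 2 ^ (2 + 2 * d * e.+1 + 2 * d * w) < _); last by rewrite ltn_exp2l.
set s := e * 2 ^ w.
have le_s : s.+1 <= 2 ^ (e.+1 + w).
  rewrite expnD /s; have : e.+1 < 2 ^ e.+1 by apply: ltn_expl.
  have : 0 < 2 ^ w by rewrite expn_gt0.
  by move: (2 ^ w) (2 ^ e.+1) => x y; nia.
have -> : 2 + 2 * d * e.+1 + 2 * d * w = (1 + (e.+1 + w) * d) * 2 by lia.
rewrite expnM leq_wexp2r // expnD expnM expn1 mul2n -addnn.
by rewrite -addn1 leq_add ?expn_gt0 //; apply: leq_wexp2r.
Qed.

(** Comparison by terms with the expansion of [(1 + #|X|)^d], using ['C(#|X|, i) <= #|X|^i]. *)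
Lemma card_small_subsets (T : finType) (X : {set T}) (d : nat) :
  #|[set S : {set T} | (S \subset X) && (#|S| <= d)]| <= #|X|.+1 ^ d.
Proof.
rewrite -sum1dep_card (partition_big (fun S : {set T} => inord #|S|) (fun _ : 'I_d.+1 => true)) //=.
rewrite -(add1n #|X|) expnDn; apply: leq_sum => i _.
rewrite sum1dep_card exp1n mul1n.
apply: (@leq_trans 'C(#|X|, i)).
  rewrite -cards_draws subset_leq_card //; apply/subsetP => S; rewrite !inE.
  by case/andP=> /andP[-> Sd] /eqP <-; rewrite inordK ?eqxx.
apply: (@leq_trans (#|X| ^ i)); last by rewrite leq_pmull // bin_gt0 -ltnS.
apply: (@leq_trans (#|X| ^_ i)); first by rewrite -bin_ffact leq_pmulr // fact_gt0.
rewrite ffact_prod -[X in _ ^ X]card_ord -prod_nat_const.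
by apply: leq_prod => j _; apply: leq_subr.
Qed.

Section Shattering.
Variable T : finType.
Implicit Types (Fam : {set {set T}}) (S A B : {set T}).

Definition shatters Fam S : bool :=
  [forall A in powerset S, exists B in Fam, B :&: S == A].

Lemma shattersP Fam S :
  reflect (forall A, A \subset S -> exists2 B, B \in Fam & B :&: S = A) (shatters Fam S).
Proof.
apply: (iffP forall_inP) => h A.
  move=> AS; have /h/exists_inP[B BF /eqP] : A \in powerset S by rewrite inE.
  by exists B.
by rewrite inE => /h[B BF BS]; apply/exists_inP; exists B => //; apply/eqP.
Qed.

Lemma shatters_sub Fam Fam' S : Fam \subset Fam' -> shatters Fam S -> shatters Fam' S.
Proof.
move=> /subsetP sub /shattersP sh; apply/shattersP => A /sh[B BF BS].
by exists B => //; apply: sub.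
Qed.

(* Pajor's form of the Sauer–Shelah lemma. *)
Lemma card_le_shattered Fam : #|Fam| <= #|[set S | shatters Fam S]|.
Proof.
have [n] := ubnP #|Fam|; elim: n => // n IHn in Fam * => leFn.
have [F1|] := leqP #|Fam| 1.
  have [->|/set0Pn[B BF]] := eqVneq Fam set0; first by rewrite cards0.
  apply: leq_trans F1 _; apply/card_gt0P; exists set0; rewrite inE.
  by apply/shattersP => A; rewrite subset0 => /eqP->; exists B; rewrite ?setI0.
case/card_gt1P=> B [B' [BF B'F BB']].
have [x xB] : exists x, (x \in B) != (x \in B').
  apply/existsP; apply: contraNT BB'; rewrite negb_exists => /forallP eqB.
  by apply/eqP/setP => x; apply/eqP; have := eqB x; rewrite negbK.
(* By induction each half of the family, split at [x], shatters at least as many sets as it has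
   members. These sets avoid [x], and if both halves shatter [S], then [Fam] shatters both [S] and
   [x |: S]. *)
pose Fx (b : bool) := [set B in Fam | (x \in B) == b].
have FxF b : Fx b \subset Fam by apply/subsetP => C; rewrite inE => /andP[].
have ltFx b : #|Fx b| < n.
  rewrite -ltnS; apply: leq_trans leFn; rewrite ltnS; apply: proper_card.
  apply/properP; split=> //.
  have [xBb|xBb] := eqVneq (x \in B) b; [exists B' => //|exists B => //]; rewrite inE.
    by rewrite B'F -xBb eq_sym (negPf xB).
  by rewrite BF (negPf xBb).
have cF : #|Fam| = #|Fx true| + #|Fx false|.
  rewrite -(cardsID [set B : {set T} | x \in B] Fam); congr (_ + _); apply: eq_card => C;
    by rewrite !inE; case: (x \in C); rewrite ?andbT ?andbF.
pose sh b := [set S | shatters (Fx b) S].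
have sh_notin b S : S \in sh b -> x \notin S.
  rewrite inE => /shattersP shS; apply/negP => xS.
  have [C + CS] := shS (if b then S :\ x else S) (ltac:(by case: (b); rewrite ?subsetDl)).
  rewrite inE => /andP[_ /eqP xC]; have /setP/(_ x) := CS.
  by rewrite inE xC xS andbT; case: (b); rewrite ?inE ?eqxx ?xS.
have shU : sh true :|: sh false \subset [set S | shatters Fam S].
  by apply/subsetP => S; rewrite !inE => /orP[]; apply: shatters_sub.
have shI : [set x |: S | S in sh true :&: sh false] \subset [set S | shatters Fam S].
  apply/subsetP => _ /imsetP[S /setIP[S1 S0] ->]; have xS := sh_notin _ _ S1.
  rewrite !inE in S0 S1 *; apply/shattersP => A AS.
  have [C + CS] : exists2 C, C \in Fx (x \in A) & C :&: S = A :\ x.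
    have AxS : A :\ x \subset S by rewrite subDset.
    by case: (x \in A); [move/shattersP: S1|move/shattersP: S0]; apply.
  rewrite inE => /andP[CF /eqP xC]; exists C => //.
  apply/setP => y; have /setP/(_ y) := CS; rewrite !inE.
  by have [->|] := eqVneq y x; rewrite /= ?xC ?andbT.
rewrite cF (leq_trans (leq_add (IHn _ (ltFx true)) (IHn _ (ltFx false)))) //.
rewrite -/(sh true) -/(sh false) -cardsUI.
rewrite -(card_in_imset (f := fun S => x |: S) (D := mem (sh true :&: sh false))); last first.
  move=> S S' /setIP[/sh_notin xS _] /setIP[/sh_notin xS' _] eqS.
  by rewrite -(setU1K xS) eqS setU1K.
rewrite -cardsUI (_ : (_ :|: _) :&: _ = set0) ?cards0 ?addn0.
  by apply: subset_leq_card; rewrite subUset shU.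
apply/setP => S; rewrite in_set0 inE; apply/negP => /andP[SU /imsetP[S' _ SS']].
have : x \notin S by case/setUP: SU => /sh_notin.
by rewrite SS' setU11.
Qed.

End Shattering.

Lemma shattered_card_le (G : sgraph) (S : {set G}) : shattered S -> #|S| <= vc_dim G.
Proof. by move=> shS; rewrite /vc_dim (bigmax_sup S). Qed.

(* A random sample of bounded size separates all pairs of a family of pairwise far
   neighbourhoods, and the Sauer–Shelah lemma bounds the number of traces on it. *)
Lemma separated_vertices_bounded (d e : nat) : 0 < e ->
  exists m, forall (G : sgraph) (M : {set G}), vc_dim G <= d ->
    {in M &, forall u v, u != v -> #|G| <= e * #|[set x | adj u x != adj v x]|} ->
    #|M| <= m.
Proof.
move=> e0; have [s hs] := expn_dominates d e0; exists (s.+1 ^ d) => G M vcG sepM.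
(* One vertex more than the number of traces that Sauer-Shelah allows on [s] points; the union bound
   then runs over boundedly many pairs. *)
rewrite leqNgt; apply/negP => ltM; pose M' := initial_subset (s.+1 ^ d).+1 M.
have cM' : #|M'| = (s.+1 ^ d).+1 by rewrite card_initial_subset.
have M'M : M' \subset M := initial_subset_sub _ _.
have G0 : 0 < #|G|.
  by rewrite (leq_trans _ (max_card (mem M'))) // cM'.
(* The samples of [s] vertices, repetitions allowed, that do not separate the pair [p]; for a pair
   in [E] their proportion is at most [((e - 1) / e)^s]. *)
pose bad (p : G * G) := [set x : {ffun 'I_s -> G} | [forall j, adj p.1 (x j) == adj p.2 (x j)]].
pose E := [pred p : G * G | (p \in setX M' M') && (p.1 != p.2)].
have bad_le p : E p -> e ^ s * #|bad p| <= (e.-1 * #|G|) ^ s.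
  case: p => u v /=; rewrite in_setX => /andP[/andP[uM vM] uv].
  have -> : #|bad (u, v)| = #|~: [set x | adj u x != adj v x]| ^ s.
    rewrite -[X in _ ^ X]card_ord -card_ffun_on; apply: eq_card => x; rewrite !inE.
    by apply/forallP/ffun_onP => h j; have := h j; rewrite !inE negbK.
  rewrite -expnMn leq_wexp2r // -(leq_add2r (e * #|[set x | adj u x != adj v x]|)).
  rewrite -mulnDr addnC cardsC.
  have := sepM u v (subsetP M'M _ uM) (subsetP M'M _ vM) uv.
  by case: (e) e0 => // f _ /=; lia.
have [x xP] : exists x, x \notin \bigcup_(p | E p) bad p.
  apply/existsP; rewrite -negb_forall; apply/negP => /forallP allx.
  have : #|{ffun 'I_s -> G}| <= #|\bigcup_(p | E p) bad p|.
    by apply: subset_leq_card; apply/subsetP => x _; apply: allx.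
  move/leq_trans/(_ (card_bigcup_le _ _)); rewrite card_ffun card_ord => h.
  suff : #|G| ^ s * e ^ s < #|G| ^ s * e ^ s by rewrite ltnn.
  apply: (@leq_ltn_trans (#|G| ^ s * ((s.+1 ^ d).+1 ^ 2 * e.-1 ^ s))); last first.
    by rewrite ltn_pmul2l // expn_gt0 G0.
  rewrite mulnC; apply: leq_trans (leq_mul (leqnn _) h) _; rewrite big_distrr /=.
  apply: (@leq_trans (\sum_(p | E p) (e.-1 * #|G|) ^ s)).
    by apply: leq_sum => p; apply: bad_le.
  have cE : #|E| <= (s.+1 ^ d).+1 ^ 2.
    rewrite -cM' -[#|M'| ^ 2]/(#|M'| * #|M'|) -cardsX.
    by apply: subset_leq_card; apply/subsetP => p; rewrite inE => /andP[].
  rewrite sum_nat_const expnMn; apply: leq_trans (leq_mul cE (leqnn _)) _.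
  by rewrite mulnA mulnC.
pose X := [set x j | j : 'I_s].
pose Fam := [set neighbours u :&: X | u in M'].
have cFam : #|Fam| = (s.+1 ^ d).+1.
  rewrite -cM'; apply: card_in_imset => u v uM vM uv; apply/eqP; apply: contraNT xP => nuv.
  apply/bigcupP; exists (u, v); first by rewrite /E /= in_setX uM vM.
  rewrite inE; apply/forallP => j /=; have /setP/(_ (x j)) := uv.
  by rewrite !inE imset_f // !andbT => ->.
(* A set shattered by the traces lies in [X] and is shattered in [G], so it has at most [d]
   elements. *)
have := card_le_shattered Fam; rewrite cFam leqNgt ltnS => /negP; apply.
apply: (@leq_trans (#|X|.+1 ^ d)); last first.
  by rewrite leq_wexp2r // ltnS (leq_trans (leq_imset_card _ _)) // card_ord.
apply: leq_trans (card_small_subsets X d); apply: subset_leq_card; apply/subsetP => S.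
rewrite !inE => /shattersP shS.
have SX : S \subset X.
  have [_ /imsetP[u _ ->] <-] := shS S (subxx _).
  by rewrite -setIA (subset_trans (subsetIr _ _)) ?subsetIl.
rewrite SX /= (leq_trans _ vcG) //; apply: shattered_card_le.
apply/eqP/setP => A; rewrite inE; apply/imsetP/idP => [[u _ ->]|/shS]; first exact: subsetIr.
by case=> _ /imsetP[u _ ->] <-; exists u; rewrite // -setIA (setIidPr SX).
Qed.

(** * Large girth and large chromatic number *)

(** Values at distinct points are independent, so a random function maps [E] into [P] with
    probability [(#|P| / #|T|)^#|E|]; here the denominators are multiplied out. *)
Lemma card_ffun_on_subset (I T : finType) (E : {set I}) (P : pred T) :
  #|[set f : {ffun I -> T} | [forall e in E, P (f e)]]| * #|T| ^ #|E| =
  #|P| ^ #|E| * #|T| ^ #|I|.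
Proof.
have -> : #|[set f : {ffun I -> T} | [forall e in E, P (f e)]]| =
          #|(family (fun e => if e \in E then P else predT) : pred {ffun I -> T})|.
  apply: eq_card => f; rewrite !inE; apply/forall_inP/familyP => fP e.
    by case: ifP => [/fP|].
  by move=> eE; have := fP e; rewrite eE.
rewrite card_family foldrE big_map big_enum /= (bigID [in E]) /=.
rewrite (eq_bigr (fun=> #|P|)) => [|e ->//].
rewrite (eq_bigr (fun=> #|T|) (P := fun e => e \notin E)) => [|e /negPf->]; last first.
  by apply: eq_card.
rewrite !prod_nat_const -mulnA -expnD; congr (_ * _ ^ _).
by rewrite addnC -(cardC [in E]).
Qed.

Lemma card_set_type (T : finType) : #|{set T}| = 2 ^ #|T|.
Proof. by rewrite -[#|{set T}|]cardsT -powersetT card_powerset cardsT. Qed.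

Lemma next_next_neq (T : eqType) (c : seq T) (x : T) :
  uniq c -> 2 < size c -> x \in c -> next c (next c x) != x.
Proof.
move=> unq szc xc; have [i c' rotc] := rot_to xc.
have unq' : uniq (rot i c) by rewrite rot_uniq.
rewrite -!(next_rot i unq); move: szc unq'; rewrite -(size_rot i) rotc.
case: c' {rotc} => [|a [|b c']] //= _; rewrite !inE !negb_or => /andP[/and3P[xa xb _] _].
by rewrite eqxx [a == x]eq_sym (negPf xa) eqxx eq_sym.
Qed.

(** If the edges leaving distinct [x] and [y] coincided, each vertex would be the successor of the
    other. Hence a cycle of length at least 3 has as many edges as vertices. *)
Lemma cycle_edge_inj (T : finType) (c : seq T) :
  uniq c -> 2 < size c -> {in c &, injective (fun x => [set x; next c x])}.
Proof.
move=> unq szc x y xc yc exy.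
have : y \in [set x; next c x] by rewrite exy set21.
have : x \in [set y; next c y] by rewrite -exy set21.
rewrite !inE => /orP[/eqP//|/eqP xy] /orP[/eqP//|/eqP yx].
by have := next_next_neq unq szc xc; rewrite -yx -xy eqxx.
Qed.

Section SampledGraph.
Variables (n q : nat).
Implicit Type f : {ffun {set 'I_n} -> 'I_q.+1}.

(* Only the values of [f] at two-element sets matter: such a set is an edge when its value is
   0, which happens with probability 1/(q+1). *)
Definition sampled_adj f : rel 'I_n := fun x y => (x != y) && (f [set x; y] == ord0).

Lemma sampled_adj_sym f : symmetric (sampled_adj f).
Proof. by move=> x y; rewrite /sampled_adj eq_sym setUC. Qed.

Lemma sampled_adj_irrefl f : irreflexive (sampled_adj f).
Proof. by move=> x; rewrite /sampled_adj eqxx. Qed.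

Definition sampled f : sgraph := SGraph (@sampled_adj_sym f) (@sampled_adj_irrefl f).

Lemma count_sampled_cycle (c : seq 'I_n) : 2 < size c ->
  #|[set f | ucycleb (sampled_adj f) c]| * q.+1 ^ size c <= q.+1 ^ 2 ^ n.
Proof.
move=> szc; have [unq|nunq] := boolP (uniq c); last first.
  rewrite (_ : [set f | _] = set0) ?cards0 //; apply/setP => f.
  by rewrite !inE /ucycleb (negPf nunq) andbF.
pose E := [set [set x; next c x] | x in c].
have cE : #|E| = size c.
  by rewrite card_in_imset; [apply/card_uniqP|apply: cycle_edge_inj].
have := card_ffun_on_subset E (pred1 (@ord0 q)).
rewrite card1 exp1n mul1n card_ord cE card_set_type card_ord => <-.
rewrite leq_mul2r; apply/orP; right; apply: subset_leq_card; apply/subsetP => f.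
rewrite !inE => /andP[cyc _]; apply/forall_inP => _ /imsetP[x xc ->].
by have /andP[] := next_cycle cyc xc.
Qed.

Lemma count_sampled_independent (S : {set 'I_n}) :
  #|[set f | @independent (sampled f) S]| * q.+1 ^ 'C(#|S|, 2)
    <= q ^ 'C(#|S|, 2) * q.+1 ^ 2 ^ n.
Proof.
have := card_ffun_on_subset [set A : {set 'I_n} | A \subset S & #|A| == 2] (predC1 (@ord0 q)).
rewrite cardC1 card_ord cards_draws card_set_type card_ord => <-.
rewrite leq_mul2r; apply/orP; right; apply: subset_leq_card; apply/subsetP => f.
rewrite !inE => /forall_inP ind; apply/forall_inP => A.
rewrite inE => /andP[AS /cards2P[x [y [xy eA]]]].
have xS : x \in S by apply: (subsetP AS); rewrite eA set21.
have yS : y \in S by apply: (subsetP AS); rewrite eA set22.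
by have /forall_inP/(_ y yS) := ind x xS; rewrite /= /sampled_adj xy /= eA.
Qed.

(** By rotation these are all the vertices on cycles of length 3 to [g]; taking heads bounds their
    number by that of the cyclic sequences. *)
Definition short_cycle_heads (g : nat) f : {set 'I_n} :=
  \bigcup_(l < g.+1 | 2 < l) \bigcup_(c : l.-tuple 'I_n | ucycleb (sampled_adj f) c)
    [set x in take 1 c].

(** There are [n ^ l] sequences of length [l], each a cycle with probability at most [1 / q.+1 ^ l]
    when [l > 2], so the mean number of these cycles is at most [D ^ l], whatever [q] is. *)
Lemma sum_short_cycle_heads (g D : nat) : n = D * q.+1 ->
  \sum_f #|short_cycle_heads g f| <= (\sum_(l < g.+1) D ^ l) * q.+1 ^ 2 ^ n.
Proof.
move=> nD; apply: (@leq_trans (\sum_f \sum_(l < g.+1 | 2 < l)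
    \sum_(c : l.-tuple 'I_n | ucycleb (sampled_adj f) c) 1)).
  apply: leq_sum => f _; apply: leq_trans (card_bigcup_le _ _) _; apply: leq_sum => l _.
  apply: leq_trans (card_bigcup_le _ _) _; apply: leq_sum => c _; rewrite cardsE.
  by apply: leq_trans (card_size _) _; rewrite size_take; case: ifP => //; lia.
rewrite exchange_big big_distrl /= big_mkcond; apply: leq_sum => l _; case: ifP => // l2.
under eq_bigr do rewrite big_mkcond.
rewrite exchange_big /= -(leq_pmul2r (_ : 0 < q.+1 ^ l)) ?expn_gt0 //.
rewrite big_distrl /= mulnAC -expnMn -nD.
apply: (@leq_trans (\sum_(c : l.-tuple 'I_n) q.+1 ^ 2 ^ n)); last first.
  by rewrite sum_nat_const card_tuple card_ord.
apply: leq_sum => c _; rewrite -big_mkcond sum1dep_card -[X in _ * _ ^ X](size_tuple c).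
by apply: count_sampled_cycle; rewrite size_tuple.
Qed.

Definition has_independent (s : nat) f : bool :=
  [exists S : {set 'I_n}, (#|S| == s) && @independent (sampled f) S].

(** A union bound over at most [2 ^ n] sets: by [double_expn_pred_mul] each is independent with
    probability at most [1 / 2 ^ n.+1]. *)
Lemma count_has_independent (s : nat) : q.+1 * n.+1 <= 'C(s, 2) ->
  2 * #|[set f | has_independent s f]| <= q.+1 ^ 2 ^ n.
Proof.
set C := 'C(s, 2) => leC.
have expC : 2 ^ n.+1 * q ^ C <= q.+1 ^ C.
  rewrite -(subnKC leC) !expnD mulnA leq_mul ?leq_wexp2r //.
  exact: (@double_expn_pred_mul q.+1 n.+1).
have sub : [set f | has_independent s f] \subset
    \bigcup_(S : {set 'I_n} | #|S| == s) [set f | @independent (sampled f) S].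
  apply/subsetP => f; rewrite inE => /existsP[S /andP[cS iS]].
  by apply/bigcupP; exists S; rewrite ?inE.
rewrite -(leq_pmul2r (_ : 0 < q.+1 ^ C)) ?expn_gt0 //.
apply: (@leq_trans (2 * (\sum_(S : {set 'I_n} | #|S| == s) q ^ C * q.+1 ^ 2 ^ n))).
  rewrite -mulnA leq_mul2l /=; apply: leq_trans (leq_mul (subset_leq_card sub) (leqnn _)) _.
  apply: leq_trans (leq_mul (card_bigcup_le _ _) (leqnn _)) _.
  rewrite big_distrl /=; apply: leq_sum => S /eqP cS.
  by have := count_sampled_independent S; rewrite cS.
rewrite sum_nat_const mulnA [X in _ <= X]mulnC mulnA leq_mul2r; apply/orP; right.
apply: leq_trans expC; rewrite leq_mul2r expnS leq_mul2l; apply/orP; right.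
by rewrite (leq_trans (max_card _)) // card_set_type card_ord.
Qed.

End SampledGraph.

(* With edge probability 1/(q+1) on D(q+1) vertices, where D depends only on k, the expected
   number of short cycles is bounded independently of q, and deleting one vertex from each of
   them costs less than half of the vertices. *)
Lemma large_girth_large_chromatic_number (g k : nat) :
  exists2 F : sgraph, k < chromatic_number F &
    forall c : seq F, ucycle (@adj F) c -> size c <= g -> size c <= 2.
Proof.
(* The value of [c] ensures [leC], and [n = 2 * (s * k.+1)]. The mean number of heads is at most
   [M], so by Markov's inequality fewer than half of the functions have more than [q] heads; at most
   half have an independent set of size [s]. *)
pose c := 4 * k.+1 + 3; pose D := 2 * k.+1 * c; pose M := \sum_(l < g.+1) D ^ l.
pose q := 2 * M; pose s := c * q.+1; pose n := D * q.+1.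
pose T := {ffun {set 'I_n} -> 'I_q.+1}.
have cT : #|T| = q.+1 ^ 2 ^ n by rewrite card_ffun card_set_type !card_ord.
have leC : q.+1 * n.+1 <= 'C(s, 2).
  rewrite bin2 -leq_double; apply: (@leq_trans (s * s.-1)); last first.
    rewrite -[X in X <= _]odd_double_half oddM.
    by case: (s) => //= s'; rewrite andNb.
  rewrite /n /D /s /c; nia.
have [f [fD fI]] : exists f : T, #|short_cycle_heads g f| <= q /\ ~~ has_independent s f.
  have sumD := @sum_short_cycle_heads n q g D erefl.
  have cI := count_has_independent leC.
  apply: contrapT => nof; pose I := [set f : T | has_independent s f].
  have : \sum_(f in ~: I) q.+1 <= M * q.+1 ^ 2 ^ n.
    apply: leq_trans sumD; rewrite [X in _ <= X](bigID [in ~: I]) /=.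
    apply: leq_trans (leq_addr _ _); apply: leq_sum => f; rewrite !inE => fI.
    by rewrite ltnNge; apply/negP => fD; apply: nof; exists f.
  rewrite sum_nat_const; have := cardsC I; move: cI; rewrite cT -/I.
  have : 0 < q.+1 ^ 2 ^ n by rewrite expn_gt0.
  by rewrite /q; move: (_ ^ 2 ^ n) #|I| #|~: I| => t i j; nia.
exists (induced (G := sampled f) (~: short_cycle_heads g f)); last first.
  move=> p /andP[cyc unq] szg; rewrite leqNgt; apply/negP => sz2.
  have szg' : size p < g.+1 by [].
  have szp : size (map val p) == Ordinal szg' by rewrite size_map.
  case: p cyc unq szg sz2 szg' szp => // x p cyc unq szg sz2 szg' szp.
  have : val x \in short_cycle_heads g f.
    apply/bigcupP; exists (Ordinal szg') => //.
    apply/bigcupP; exists (Tuple szp); last by rewrite inE /= take0 mem_head.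
    apply/andP; split; last by rewrite map_inj_uniq //; apply: val_inj.
    by rewrite /= -map_rcons path_map.
  by have := valP x; rewrite inE => /negPf->.
rewrite ltnNge; apply/negP => /leqW/chromatic_number_coloring[h hP].
set F := induced _ in h hP.
have cF : #|F| = #|~: short_cycle_heads g f| by rewrite card_sig.
have qs : q < s by rewrite /s leq_pmull // /c addn3.
have s0 : 0 < s by apply: leq_ltn_trans qs.
(* After the deletion more than [s.-1 * k.+1] vertices remain, so some colour class has at least [s]
   of them. *)
have [||i _ ci] := @pigeonhole F _ setT setT h s.-1.
- by move=> x _; rewrite inE.
- rewrite !cardsT card_ord cF -(ltn_add2l #|short_cycle_heads g f|) cardsC card_ord.
  apply: leq_ltn_trans (_ : q + s.-1 * k.+1 < n); first by rewrite leq_add2r.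
  have -> : n = 2 * (s * k.+1) by rewrite /n /D -!mulnA [k.+1 * _]mulnC -mulnA.
  apply: (@leq_ltn_trans (q + s * k.+1)); first by rewrite leq_add2l leq_mul2r leq_pred orbT.
  by rewrite mul2n -addnn ltn_add2r (leq_trans qs) // leq_pmulr.
pose S : {set 'I_n} := val @: [set x in setT | h x == i].
have /card_initial_subset cS : s <= #|S|.
  by rewrite card_imset; [rewrite -(prednK s0)|apply: val_inj].
case/negP: fI; apply/existsP; exists (initial_subset s S); rewrite cS eqxx /=.
apply/forall_inP => x /(subsetP (initial_subset_sub _ _))/imsetP[x' + ->].
rewrite !inE => /= /eqP hx; apply/forall_inP => y.
move/(subsetP (initial_subset_sub _ _))/imsetP=> [y' + ->]; rewrite !inE => /= /eqP hy.
by apply/negP => /(hP x' y'); rewrite hx hy eqxx.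
Qed.

(** * Joins with independent sets *)

(** The number [m] is kept free because [r - 3] is used as well as [r - 2], where [r] is the
    chromatic number of [H]. *)
Definition forest_decomposition (H : sgraph) (m : nat) : Prop :=
  exists (A : 'I_m -> {set H}) (B : {set H}),
    [/\ (\bigcup_i A i) :|: B = [set: H],
        forall i j, i != j -> [disjoint A i & A j],
        forall i, [disjoint A i & B],
        forall i, independent (A i)
      & forest (induced B)].

Lemma forest_isomorphic (F G : sgraph) : isomorphic F G -> forest F -> forest G.
Proof.
case=> f [f' fK f'K] fA forF c /andP[cyc unq]; rewrite -(size_map f').
apply: forF; apply/andP; split; last by rewrite map_inj_uniq //; apply: can_inj f'K.
by apply: homo_cycle cyc => x y; rewrite -fA !f'K.
Qed.

Lemma decomposition_family_forest (H : sgraph) :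
  (exists2 F, decomposition_family H F & forest F) <->
  forest_decomposition H (chromatic_number H - 2).
Proof.
split=> [[F [A [B [cov disA disB indA isoF]]] forF]|[A [B [cov disA disB indA forB]]]].
  by exists A, B; split=> //; apply: forest_isomorphic forF.
exists (induced B) => //; exists A, B; split=> //.
by exists id => //; exists id.
Qed.

(** One colour for each [A i] and two for the forest, which is 1-degenerate. *)
Lemma forest_decomposition_chromatic (H : sgraph) (m : nat) :
  forest_decomposition H m -> chromatic_number H <= m + 2.
Proof.
case=> A [B [cov disA disB indA forB]].
have [|h hP] := @degenerate_coloring (induced B) 1 setT.
  by move=> U _; apply: forest_low_degree.
pose f (x : H) : 'I_m + 'I_2 :=
  if insub x is Some y then inr (h y)
  else if [pick i | x \in A i] is Some i then inl i else inr ord0.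
have -> : m + 2 = #|{: 'I_m + 'I_2}| by rewrite card_sum !card_ord.
apply: (@chromatic_number_le H _ f) => x y xy; rewrite /f.
have inA z : z \notin B -> exists i, z \in A i.
  move=> zB; have : z \in [set: H] by rewrite inE.
  by rewrite -cov inE (negPf zB) orbF => /bigcupP[i _]; exists i.
case: insubP => [x' _ xx'|/inA[i0 xi0]]; case: insubP => [y' _ yy'|/inA[j0 yj0]].
- by apply/eqP => -[] /eqP; apply/negP; apply: hP; rewrite ?inE //= /induced_adj xx' yy'.
- by case: pickP => // no; rewrite no in yj0.
- by case: pickP => // no; rewrite no in xi0.
case: pickP => [i xi|no]; last by rewrite no in xi0.
case: pickP => [j yj|no]; last by rewrite no in yj0.
apply/eqP => -[] ij; have /forall_inP/(_ x xi)/forall_inP/(_ y) := indA i.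
by rewrite ij yj xy => /(_ isT).
Qed.

Section Join.
Variables (m : nat) (F : sgraph).

Definition join_adj : rel (F + 'I_m * F) := fun u v =>
  match u, v with
  | inl x, inl y => adj x y
  | inr p, inr p' => p.1 != p'.1
  | _, _ => true
  end.

Lemma join_adj_sym : symmetric join_adj.
Proof. by move=> [x|p] [y|p'] //=; [rewrite adj_sym|rewrite eq_sym]. Qed.

Lemma join_adj_irrefl : irreflexive join_adj.
Proof. by move=> [x|p] /=; rewrite ?adj_irrefl ?eqxx. Qed.

Definition join : sgraph := SGraph join_adj_sym join_adj_irrefl.

Lemma card_join : #|join| = m.+1 * #|F|.
Proof. by rewrite card_sum card_prod card_ord mulSn. Qed.

(** All nonneighbours of a vertex lie in its own part, which has [#|F|] vertices. *)
Lemma join_min_degree : m * #|F| <= min_degree join.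
Proof.
have degv (v : join) : m * #|F| <= #|neighbours v|.
  have [h hv] : exists h : F -> join, ~: neighbours v \subset h @: setT.
    case: v => [x|[i x]]; [exists (fun y => inl y)|exists (fun y => inr (i, y))].
      by apply/subsetP => -[y _|p]; [apply: imset_f|rewrite !inE].
    apply/subsetP => -[y|[j y]]; rewrite !inE // negbK => /eqP /= <-.
    exact: (imset_f (fun y => inr (i, y))).
  have := leq_trans (subset_leq_card hv) (leq_imset_card h _); rewrite cardsT => ch.
  rewrite -(leq_add2r #|~: neighbours v|) cardsC card_join mulSn addnC.
  by rewrite leq_add2r.
rewrite /min_degree; elim/big_rec: _ => [|v d _ dm]; first by rewrite card_join mulSn leq_addl.
by rewrite leq_min degv.
Qed.

Lemma join_chromatic_number : chromatic_number F <= chromatic_number join.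
Proof.
have [h hP] := chromatic_number_coloring (leqnn (chromatic_number join)).
rewrite -[X in _ <= X]card_ord; apply: (chromatic_number_le (f := fun x => h (inl x))).
by move=> x y xy; apply: hP.
Qed.

(** A shattered set has at most one vertex in each independent part, whose vertices are twins, and
    at most three in [F]. Given four, [a], [b], [c], [e], the traces [{a, b}] and [{a, b, c}] omit
    [e] and so come from vertices [v], [w] of [F]; these differ at [c] and form a 4-cycle with [a]
    and [b]. *)
Lemma join_vc_dim :
  (forall c : seq F, ucycle (@adj F) c -> size c <= 4 -> size c <= 2) ->
  vc_dim join <= m + 3.
Proof.
move=> C4_free.
apply/bigmax_leqP => S shS.
have trace (A : {set join}) : A \subset S ->
    exists v : join, forall x, x \in S -> join_adj v x = (x \in A).
  move=> AS; have : A \in powerset S by rewrite inE.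
  rewrite -(eqP shS) => /imsetP[v _ ->]; exists v => x xS.
  by rewrite !inE xS andbT.
pose SF := [set x in S | if x is inl _ then true else false].
pose P := [set x in S | if x is inl _ then false else true].
have -> : #|S| = #|P| + #|SF|.
  rewrite -(cardsID P S); congr (_ + _); apply: eq_card => x; rewrite !inE;
  by case: (x \in S) => //=; case: x.
apply: leq_add.
  pose part (x : join) : option 'I_m := if x is inr p then Some p.1 else None.
  have partI : {in P &, injective part}.
    move=> [x|p] [y|p']; rewrite !inE ?andbF // !andbT => pS p'S [pp'].
    have [|v vP] := trace [set inr p]; first by rewrite sub1set.
    have := vP _ pS; have := vP _ p'S; rewrite !inE eqxx.
    rewrite (_ : join_adj v (inr p') = join_adj v (inr p)); first by move=> -> /eqP.
    by case: (v) => //= p0; rewrite pp'.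
  rewrite -(card_in_imset partI) -[X in _ <= X]card_ord -cardsT.
  apply: leq_trans (leq_imset_card (@Some 'I_m) _); apply: subset_leq_card.
  apply/subsetP => _ /imsetP[[x|p] + ->]; rewrite inE ?andbF // => _.
  exact: imset_f.
rewrite leqNgt; apply/negP => SF3.
have [e eSF] : exists e, e \in SF by apply/set0Pn; rewrite -card_gt0; lia.
have : 2 < #|SF :\ e| by rewrite (cardsD1 e) eSF in SF3.
case/card_gt2P => [a [b [c [[]]]]]; rewrite !inE.
move: eSF; rewrite inE.
case: e => [e|?]; last by rewrite andbF.
case: a => [a|?]; last by rewrite !andbF.
case: b => [b|?]; last by rewrite !andbF.
case: c => [c|?]; last by rewrite !andbF.
rewrite !andbT => eS /andP[ae aS] /andP[be bS] /andP[ce cS] [ab bc ca].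
have [|v vP] := trace [set inl a; inl b]; first by rewrite subUset !sub1set aS.
have [|w wP] := trace [set inl a; inl b; inl c]; first by rewrite !subUset !sub1set aS bS.
have := vP _ eS; have := wP _ eS; rewrite !inE ![inl e == _]eq_sym (negPf ae) (negPf be) (negPf ce).
case: w wP => [w|?] wP //= _; case: v vP => [v|?] vP //= _.
have := vP _ aS; have := vP _ bS; have := vP _ cS; have := wP _ aS; have := wP _ bS.
have := wP _ cS; rewrite !inE !eqxx ?orbT ![inl c == inl b]eq_sym (negPf bc) (negPf ca) /=.
move=> wc wb wa vc vb va.
suff /C4_free/(_ isT) : ucycle (@adj F) [:: a; v; b; w] by [].
have neq (x y : F) : adj x y -> x != y by apply: contraTneq => ->; rewrite adj_irrefl.
rewrite /ucycle /ucycleb /= adj_sym va vb (adj_sym b) wb wa /= !inE !negb_or.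
rewrite eq_sym (neq _ _ va) (neq _ _ vb) [a == w]eq_sym (neq _ _ wa) [b == w]eq_sym (neq _ _ wb).
rewrite (_ : (a != b) = true) //=; apply/andP; split=> //.
by apply: contraTneq wc => <-; rewrite vc.
Qed.

End Join.

(** The independent sets are the preimages of the [m] parts. A cycle in the rest of [H] has at most
    [#|H|] vertices and is mapped to a cycle of [F]. *)
Lemma join_copy_decomposition (m : nat) (F H : sgraph) :
  (forall c : seq F, ucycle (@adj F) c -> size c <= #|H| -> size c <= 2) ->
  contains_copy H (join m F) -> forest_decomposition H m.
Proof.
move=> girthF [f fI fA].
exists (fun i => [set x | if f x is inr p then p.1 == i else false]).
exists [set x | if f x is inl _ then true else false]; split.
- apply/setP => x; rewrite !inE; case fx: (f x) => [y|p]; first by rewrite orbT.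
  by rewrite orbF; apply/bigcupP; exists p.1; rewrite // inE fx eqxx.
- move=> i j ij; apply/pred0P => x /=; rewrite !inE; case: (f x) => // p.
  by apply: contraNF ij => /andP[/eqP <- /eqP <-].
- by move=> i; apply/pred0P => x /=; rewrite !inE; case: (f x) => ? /=; rewrite ?andbF.
- move=> i; apply/forall_inP => x; rewrite inE; case fx: (f x) => [//|p] /eqP pi.
  apply/forall_inP => y; rewrite inE; case fy: (f y) => [//|p'] /eqP p'i.
  by apply/negP => /fA; rewrite fx fy /= pi p'i eqxx.
set B := [set x | _] => c /andP[cyc unq].
case: c cyc unq => // x0 c cyc unq.
have := valP x0; rewrite inE; case fx0: (f (val x0)) => [y0|//] _.
pose h (x : induced B) := if f (val x) is inl y then y else y0.
have hP x : f (val x) = inl (h x).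
  by have := valP x; rewrite inE /h; case: (f (val x)).
have hI : injective h by move=> x y hxy; apply/val_inj/fI; rewrite !hP hxy.
rewrite -(size_map h); apply: girthF.
  apply/andP; split; last by rewrite map_inj_uniq.
  by apply: homo_cycle cyc => x y /fA; rewrite !hP.
rewrite size_map -(card_uniqP unq); apply: leq_trans (max_card _) _.
by rewrite card_sig max_card.
Qed.

(** * Upper bounds *)

(** A vertex outside [B] goes to the part numbered by some [A i] containing it, at the place given
    by [enum_rank], for which a part of size [#|H|] has room. Adjacent vertices outside [B] get
    different parts, as [A i] is independent. *)
Lemma embed_in_parts (H G : sgraph) (k : nat) (A : 'I_k -> {set H}) (B : {set H})
    (g : H -> G) (W : {set G}) (s : seq {set G}) :
  (\bigcup_i A i) :|: B = [set: H] -> (forall i, independent (A i)) ->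
  {in B &, injective g} -> {in B &, forall x y, adj x y -> adj (g x) (g y)} ->
  {in B & W, forall x w, adj (g x) w} ->
  size s = k -> complete_parts #|H| W s -> contains_copy H G.
Proof.
move=> cov indA gI gA gW szs /andP[pws /allP allW].
pose idx (x : H) : nat := if [pick i | x \in A i] is Some i then i : nat else 0.
have idxP x : x \notin B -> exists2 i : 'I_k, x \in A i & idx x = i.
  move=> xB; rewrite /idx; case: pickP => [i xi|no]; first by exists i.
  have : x \in [set: H] by rewrite inE.
  by rewrite -cov inE (negPf xB) orbF => /bigcupP[i _]; rewrite no.
have idx_lt x : x \notin B -> idx x < size s.
  by move=> xB; rewrite szs; have [i _ ->] := idxP x xB.
pose part x := nth set0 s (idx x).
have partP x : x \notin B -> part x \subset W /\ #|part x| = #|H|.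
  by move=> xB; have /andP[? /eqP] := allW (part x) (mem_nth _ (idx_lt x xB)).
pose f x := if x \in B then g x else nth (g x) (enum (part x)) (enum_rank x).
have rank_lt (x y : H) : y \notin B -> enum_rank x < size (enum (part y)).
  by move=> yB; rewrite -cardE; have [_ ->] := partP y yB; apply: ltn_ord.
have fpart x : x \notin B -> f x \in part x.
  move=> xB; rewrite /f (negPf xB) -mem_enum mem_nth //.
  exact: rank_lt.
have fW x : x \notin B -> f x \in W.
  by move=> xB; apply: (subsetP (proj1 (partP x xB))); apply: fpart.
have fBadj x y : x \in B -> y \notin B -> adj (f x) (f y).
  by move=> xB yB; rewrite {1}/f xB; apply: gW => //; apply: fW.
have fadj x y : x \notin B -> y \notin B -> idx x != idx y -> adj (f x) (f y).
  wlog xy : x y / idx x < idx y => [hw xB yB|xB yB _].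
    rewrite neq_ltn => /orP[] lt; [|rewrite adj_sym]; apply: hw => //;
    by rewrite neq_ltn lt ?orbT.
  have /complete_pairP := pairwiseP set0 pws (idx x) (idx y) (idx_lt x xB) (idx_lt y yB) xy.
  by apply; apply: fpart.
exists f => x y.
  have [xB|xB] := boolP (x \in B); have [yB|yB] := boolP (y \in B).
  - by rewrite /f xB yB; apply: gI.
  - by move=> fxy; have := fBadj x y xB yB; rewrite fxy adj_irrefl.
  - by move=> fxy; have := fBadj y x yB xB; rewrite fxy adj_irrefl.
  have [ixy|/fadj h] := eqVneq (idx x) (idx y); last first.
    by move=> fxy; have := h xB yB; rewrite fxy adj_irrefl.
  have pxy : part x = part y by rewrite /part ixy.
  rewrite /f (negPf xB) (negPf yB) pxy (set_nth_default (g x) (g y)) ?rank_lt //.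
  by move/eqP; rewrite nth_uniq ?enum_uniq ?rank_lt // => /eqP/ord_inj/enum_rank_inj.
move=> xy; have [xB|xB] := boolP (x \in B); have [yB|yB] := boolP (y \in B).
- by rewrite /f xB yB; apply: gA.
- exact: fBadj.
- by rewrite adj_sym; apply: fBadj.
apply: fadj => //; have [i xi ->] := idxP x xB; have [j yj ->] := idxP y yB.
apply: contraTneq xy => /ord_inj ij; rewrite -ij in yj.
by have /forall_inP/(_ x xi)/forall_inP/(_ y yj) := indA i.
Qed.

(** The [k.+2] parts found by [erdos_stone] in the whole graph receive the colour classes of [H].
    The degree condition, in integers, asks for at least [k / k.+1 + 1 / p] times the order. *)
Lemma contains_copy_large_min_degree (H : sgraph) (k p : nat) :
  0 < p -> chromatic_number H <= k.+2 ->
  exists N, forall G : sgraph, N < #|G| ->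
    (k * p + k.+1) * #|G| <= k.+1 * p * min_degree G -> contains_copy H G.
Proof.
move=> p0 /chromatic_number_coloring[h hP].
have [N hN] := erdos_stone k.+1 #|H| p0; exists N => G NG degG.
have [x0 _] : exists x : G, x \in [set: G] by apply/card_gt0P; rewrite cardsT; lia.
have [||s szs sP] := hN G [set: G]; first by rewrite cardsT ltnW.
  move=> w _; have := min_degree_le w; have := cardsC (neighbours w).
  rewrite setTD cardsT => <- db.
  have := leq_trans degG (leq_mul (leqnn (k.+1 * p)) db); rewrite -(cardsC (neighbours w)).
  by move: #|~: _| #|neighbours w| => a b; case: p p0 {hN degG} => // p _; nia.
apply: (@embed_in_parts H G k.+2 (fun i => [set x | h x == i]) set0 (fun=> x0) setT s) => //.
- by apply/setP => x; rewrite !inE orbF; apply/bigcupP; exists (h x); rewrite ?inE.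
- move=> i; apply/forall_inP => x; rewrite inE => /eqP hx; apply/forall_inP => y.
  by rewrite inE => /eqP hy; apply/negP => /hP; rewrite hx hy eqxx.
- by move=> x y; rewrite inE.
- by move=> x y; rewrite inE.
- by move=> x y; rewrite inE.
Qed.

(** The representatives form a maximal set of pairwise far vertices, so every vertex is close to one
    of them. *)
Lemma closeness_classes (d e : nat) : 0 < e ->
  exists m, forall G : sgraph, vc_dim G <= d -> 0 < #|G| ->
    exists2 M : {set G}, #|M| <= m &
      exists rep : G -> {u | u \in M},
        forall v, e * #|[set x | adj (val (rep v)) x != adj v x]| < #|G|.
Proof.
move=> e0; have [m hm] := separated_vertices_bounded d e0; exists m => G vcG G0.
pose far u v := #|G| <= e * #|[set x | @adj G u x != adj v x]|.
pose sep (M : {set G}) := [forall u in M, forall v in M, (u != v) ==> far u v].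
have sepP (M : {set G}) : reflect {in M &, forall u v, u != v -> far u v} (sep M).
  apply: (iffP forall_inP) => [h u v uM vM uv|h u uM].
    by have /forall_inP/(_ v vM)/implyP := h u uM; apply.
  by apply/forall_inP => v vM; apply/implyP; apply: h.
have far_sym u v : far u v = far v u.
  by rewrite /far; congr (_ <= _ * _); apply: eq_card => x; rewrite !inE eq_sym.
have [|M /maxsetP[sepM maxM] _] := @maxset_exists _ sep set0.
  by apply/sepP => u v; rewrite inE.
exists M; first by apply: hm => //; apply/sepP.
apply: (@fin_all_exists _ _ (fun v (u : {u | u \in M}) =>
    e * #|[set x | adj (val u) x != adj v x]| < #|G|)) => v.
have [vM|vM] := boolP (v \in M).
  exists (exist _ v vM); rewrite (_ : [set x | _] = set0) ?cards0 ?muln0 //.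
  by apply/setP => x; rewrite !inE eqxx.
suff /exists_inP[u uM uv] : [exists u in M, ~~ far u v].
  by exists (exist _ u uM); rewrite ltnNge.
apply: contraNT vM; rewrite negb_exists_in => /forall_inP farM.
suff <- : v |: M = M by rewrite setU11.
apply: maxM (subsetUr _ _); apply/sepP => u w /setU1P[->|uM] /setU1P[->|wM].
- by rewrite eqxx.
- by move=> _; rewrite far_sym; have := farM w wM; rewrite negbK.
- by move=> _; have := farM u uM; rewrite negbK.
- by apply: (sepP _ sepM).
Qed.

Lemma forest_decomposition_chromatic_bounded (H : sgraph) (k p d : nat) :
  0 < p -> forest_decomposition H k.+1 ->
  exists C, forall G : sgraph, H_free H G -> vc_dim G <= d ->
    (k * p + k.+1) * #|G| <= k.+1 * p * min_degree G -> chromatic_number G <= C.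
Proof.
move=> p0 [A [B [cov _ _ indA forB]]].
(* With this closeness, the common neighbourhood of a copy of [B] in one class misses at most
   [#|G| / (2 * p)] neighbours of the representative, half of the surplus in the degree
   condition. *)
have e0 : 0 < 2 * p * #|H|.+1 by rewrite !muln_gt0 p0.
have [m hm] := closeness_classes d e0.
have [N hN] := @erdos_stone k #|H| (2 * p).+1 (ltn0Sn _).
(* Small graphs get one colour per vertex, the others [#|H|.+1] colours for each of at most [m]
   classes. *)
exists (maxn (2 * p * N) (m * #|H|.+1)) => G Hfree vcG degG.
rewrite leq_max; have [|ltG] := leqP #|G| (2 * p * N).
  by move/(leq_trans (chromatic_number_le_card G)) ->.
have [M cM [rep repP]] := hm G vcG (leq_ltn_trans (leq0n _) ltG); apply/orP; right.
have [|nocol] := pselect (forall u, exists f : G -> 'I_#|H|.+1,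
    {in [set v | rep v == u] &, forall x y, adj x y -> f x != f y}).
  case/fin_all_exists=> f fP.
  apply: leq_trans (_ : #|{: {u | u \in M} * 'I_#|H|.+1}| <= _); last first.
    by rewrite card_prod card_sig card_ord leq_mul2r cM orbT.
  apply: (chromatic_number_le (f := fun v => (rep v, f (rep v) v))) => x y xy.
  rewrite xpair_eqE negb_and -implybE; apply/implyP => /eqP rxy.
  by rewrite -rxy; apply: fP; rewrite ?inE ?rxy.
(* A class without such a colouring would contain a set [U] whose inner degrees exceed [#|H|], and
   the forest embeds into [U]. *)
case: nocol => u; apply: degenerate_coloring => U sU U0; apply: contrapT => noU.
have degU v : v \in U -> #|H| <= #|neighbours v :&: U|.
  by move=> vU; rewrite leqNgt; apply/negP => /ltnW vlt; apply: noU; exists v.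
have cB : #|induced B| <= #|H| by rewrite card_sig max_card.
have [|g [gI gU gA]] := forest_embedding forB U0.
  by move=> v /degU; apply: leq_trans.
pose W := [set w | [forall b, adj (g b) w]].
have cW : 2 * p * #|neighbours (val u) :\: W| <= #|G|.
  pose far b := [set x | adj (val u) x != adj (g b) x].
  have sub : neighbours (val u) :\: W \subset \bigcup_b far b.
    apply/subsetP => x; rewrite !inE => /andP[/forallPn[b gbx] ux].
    by apply/bigcupP; exists b; rewrite // inE ux (negPf gbx).
  rewrite -(leq_pmul2l (ltn0Sn #|H|)) mulnCA mulnA.
  apply: (@leq_trans (2 * p * #|H|.+1 * \sum_b #|far b|)).
    by rewrite leq_mul2l (leq_trans (subset_leq_card sub) (card_bigcup_le _ _)) orbT.
  apply: (@leq_trans (\sum_(b : induced B) #|G|)); last first.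
    by rewrite sum_nat_const leq_mul2r (leq_trans cB) ?orbT.
  rewrite big_distrr; apply: leq_sum => b _ /=; apply: ltnW.
  by have := repP (g b); have := subsetP sU _ (gU b); rewrite inE => /eqP->.
have degW : 2 * p * min_degree G <= 2 * p * #|W| + #|G|.
  apply: leq_trans (leq_add (leqnn _) cW); rewrite -mulnDr leq_mul2l.
  apply/orP; right; apply: leq_trans (min_degree_le (val u)) _.
  rewrite -(cardsID W (neighbours (val u))) leq_add2r.
  by apply: subset_leq_card; apply: subsetIr.
have [||s szs sP] := hN G W.
(* The degree condition gives [#|G| <= p * min_degree G], so [W] keeps at least [#|G| / (2 * p)]
   vertices. *)
- have : k.+1 * #|G| <= k.+1 * (p * min_degree G).
    by rewrite mulnA; apply: leq_trans degG; rewrite leq_mul2r leq_addl orbT.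
  rewrite leq_pmul2l // => Gp; rewrite -(leq_pmul2l (_ : 0 < 2 * p)) ?muln_gt0 //.
  by move: ltG degW Gp; rewrite -!mulnA; lia.
- move=> w _.
  have nonadj : #|W :\: neighbours w| + min_degree G <= #|G|.
    rewrite -(cardsC (neighbours w)) addnC leq_add ?min_degree_le //.
    by apply: subset_leq_card; apply/subsetP => x; rewrite !inE => /andP[].
  (* What [erdos_stone] requires once [#|W|] is bounded by [degW] and the nonneighbours by
     [nonadj]. *)
  have degG' : ((2 * p).+1 * k + 1) * #|G| <= (2 * p + (2 * p).+1 * k) * min_degree G.
    have V0 : 0 < k.+1 * p by rewrite muln_gt0.
    rewrite -(leq_pmul2l V0) [X in _ <= X]mulnCA.
    apply: leq_trans (leq_mul (leqnn _) degG).
    by rewrite !mulnA leq_mul2r; apply/orP; right; nia.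
  rewrite -(leq_add2r #|G|); apply: leq_trans degW.
  apply: leq_trans (_ : (2 * p).+1 * k * (#|G| - min_degree G) + #|G| <= _).
    by rewrite leq_add2r leq_mul2l leq_subRL ?orbT //; lia.
  have := leq_mul (leqnn ((2 * p).+1 * k)) (leq_trans (leq_addl _ _) nonadj).
  by move: degG'; rewrite mulnBr !mulnDl mul1n; lia.
have [v0 v0U] := set0Pn _ U0.
apply: Hfree; apply: (@embed_in_parts H G k.+1 A B
    (fun x => if insub x is Some b then g b else v0) W s) => //.
- move=> x y xB yB; rewrite !insubT => /gI; exact: (congr1 val).
- move=> x y xB yB xy; rewrite !insubT; exact: gA.
- move=> x w xB; rewrite insubT inE => /forallP; exact.
Qed.

(** * The threshold *)

Import Order.TTheory GRing.Theory Num.Theory.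
Local Open Scope ring_scope.

Lemma vc_admissible_gt (R : realType) (H : sgraph) (m : nat) (gamma : R) :
  ~ forest_decomposition H m -> vc_admissible H gamma -> m%:R / m.+1%:R < gamma.
Proof.
move=> noforest [_ /(_ (m + 3)%N)]; rewrite addn3 => /(_ isT)[C hC].
rewrite ltNge; apply/negP => le_gamma.
(* Girth above [#|H|] keeps [H] out of the join; girth above 4 bounds its VC dimension. *)
have [F chiF girthF] := large_girth_large_chromatic_number (maxn #|H| 4) C.
have : (chromatic_number (join m F) <= C)%N.
  apply: hC.
  - move/join_copy_decomposition => dec; apply: noforest; apply: dec => c cyc cH.
    by apply: girthF => //; rewrite leq_max cH.
  - apply: le_trans (_ : (m * #|F|)%N%:R <= _); last by rewrite ler_nat join_min_degree.
    rewrite card_join !natrM mulrA ler_wpM2r ?ler0n //.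
    by rewrite -ler_pdivlMr ?ltr0n.
  - rewrite -addn3; apply: join_vc_dim => c cyc c4.
    by apply: girthF => //; rewrite leq_max c4 orbT.
by rewrite leqNgt (leq_trans chiF (join_chromatic_number _ _)).
Qed.

(** Any [p] with [1 / p <= gamma - k / k.+1] works; this gives the integer degree condition of the
    upper bounds. *)
Lemma degree_condition_nat (R : realType) (gamma : R) (k : nat) :
  k%:R / k.+1%:R < gamma ->
  exists2 p : nat, (0 < p)%N & forall n d : nat, gamma * n%:R <= d%:R ->
    ((k * p + k.+1) * n <= k.+1 * p * d)%N.
Proof.
rewrite -subr_gt0; set eps := gamma - _ => eps0.
have [p p0 pE] : exists2 p : nat, (0 < p)%N & p%:R^-1 <= eps.
  exists (Num.bound eps^-1).+1 => //.
  rewrite invf_ple ?posrE ?ltr0n // ltW // (lt_trans (archi_boundP _)) ?ltr_nat //.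
  by rewrite invr_ge0 ltW.
exists p => // n d nd; rewrite -(ler_nat R) !natrM natrD natrM.
have k0 : (k.+1%:R : R) != 0 by rewrite pnatr_eq0.
have p0' : (p%:R : R) != 0 by rewrite pnatr_eq0 -lt0n.
have -> : k%:R * p%:R + k.+1%:R = k.+1%:R * p%:R * (k%:R / k.+1%:R + p%:R^-1) :> R.
  by field; rewrite p0' nat1r k0.
rewrite -(mulrA (k.+1%:R * p%:R)) ler_wpM2l ?mulr_ge0 ?ler0n //; apply: le_trans nd.
by rewrite ler_wpM2r ?ler0n // addrC -lerBrDr.
Qed.

Lemma vc_chromatic_threshold_eq (R : realType) (H : sgraph) (a : R) :
  (forall gamma : R, vc_admissible H gamma -> a < gamma) ->
  (forall gamma : R, a < gamma -> vc_admissible H gamma) ->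
  vc_chromatic_threshold R H = a.
Proof.
move=> adm_gt gt_adm; have [ne lb] := has_inf_vc_admissible R H.
apply/eqP; rewrite eq_le; apply/andP; split.
  apply/ler_addgt0Pr => e e0; apply: ge_inf => //; apply: gt_adm.
  by rewrite ltrDl.
by apply: lb_le_inf => // gamma /adm_gt/ltW.
Qed.

Theorem theorem1p8 (R : realType) (H : sgraph) (r : nat)
    (hr : (3 <= r)%N) (hH : chromatic_number H = r) :
  (vc_chromatic_threshold R H = (r%:R - 3) / (r%:R - 2) \/
   vc_chromatic_threshold R H = (r%:R - 2) / (r%:R - 1)) /\
  (vc_chromatic_threshold R H = (r%:R - 2) / (r%:R - 1) <->
   ~ exists2 F : sgraph, decomposition_family H F & forest F).
Proof.
rewrite decomposition_family_forest hH.
case: r hr hH => [|[|[|k]]] // _ hH; rewrite !subSS subn0.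
have -> : k.+3%:R - 3 = k%:R :> R by rewrite -natrB // !subSS subn0.
have -> : k.+3%:R - 2 = k.+1%:R :> R by rewrite -natrB // !subSS subn0.
have -> : k.+3%:R - 1 = k.+2%:R :> R by rewrite -[k.+3]addn1 natrD addrK.
have pos (j : nat) (gamma : R) : j%:R / j.+1%:R < gamma -> 0 < gamma.
  by apply: le_lt_trans; rewrite divr_ge0 ?ler0n.
have [dec|nodec] := pselect (forest_decomposition H k.+1).
  have -> : vc_chromatic_threshold R H = k%:R / k.+1%:R.
    apply: vc_chromatic_threshold_eq => gamma.
      (* A forest and only [k = r - 3] independent sets would allow a colouring with [k.+2 < r]
         colours. *)
      by apply: vc_admissible_gt => /forest_decomposition_chromatic; rewrite hH addn2 ltnn.
    move=> gt; split=> [|d _]; first exact: pos gt.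
    have [p p0 pP] := degree_condition_nat gt.
    have [C hC] := forest_decomposition_chromatic_bounded d p0 dec.
    by exists C => G Hfree degG vcG; apply: hC => //; apply: pP.
  split; first by left.
  split=> [/eqP|]; last by move=> /(_ dec).
  rewrite eqr_div ?pnatr_eq0 // -!natrM eqr_nat => /eqP; lia.
have -> : vc_chromatic_threshold R H = k.+1%:R / k.+2%:R.
  apply: vc_chromatic_threshold_eq => gamma; first exact: vc_admissible_gt.
  move=> gt; split=> [|d _]; first exact: pos gt.
  have [p p0 pP] := degree_condition_nat gt.
  have [|N hN] := @contains_copy_large_min_degree H k.+1 p p0; first by rewrite hH.
  exists N => G Hfree /pP degG _; apply: leq_trans (chromatic_number_le_card G) _.
  by rewrite leqNgt; apply/negP => NG; apply: Hfree; apply: hN.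
by split; [right|split].
Qed.
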